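(* Let $m\in\mathcal{M}$ and let $\bm{\pi}^e$ be the subchannel assigning vector of all real and virtual users. If users $n_1,\dots,n_i$ compose a negative differ-group loop $n_1\to\cdots\to n_i\to n_1$ in the weighted directed graph $G^m(\mathcal{V}^e,\mathcal{E}^e,\mathcal{W}^e;\bm{\pi}^e)$, then the total transmit power is strictly reduced by the operations $(n_1\rightarrow\pi_{n_2}),\dots,(n_{i-1}\rightarrow\pi_{n_i}),(n_i\rightarrow\pi_{n_1})$.
   Context: System: $\mathcal{M}=\{1,\dots,M\}$ base stations (BSs), $\mathcal{N}=\{1,\dots,N\}$ (real) users, $\mathcal{G}=\{1,\dots,G\}$ channels available in every BS. Each user is associated with one fixed BS; $\mathcal{U}^m$ is the set of users of BS $m$. A subchannel assigning vector $\bm{\pi}$ assigns to each user $n$ a channel $\pi_n\in\mathcal{G}$; the group $mg$ is $\mathcal{U}^{m,g}=\{n\in\mathcal{U}^m:\pi_n=g\}$. $H^{m,g}_n\ne0$ is the channel coefficient between BS $m$ and user $n$ on channel $g$, $\sigma^2>0$ the noise power, $r_n\ge0$ the target rate of user $n$. Virtual users: for each group of each BS one virtual user is added, associated with that BS and initially assigned to that group, with target rate $0$ (and arbitrary nonzero channel coefficients). $\bm{\pi}^e$ is the subchannel assigning vector of all real and virtual users, in which each group contains exactly its one virtual user together with its real users. Power: the powers $p_n\ge0$ under an assignment are the solution of $$p_n=(2^{r_n}-1)\Big(\frac{I_n+\sigma^2}{|H^{m,g}_n|^2}+\sum_{i\in\mathcal{U}^{m,g}:\,S^{m,g}_i>S^{m,g}_n}p_i\Big),\quad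 n\in\mathcal{U}^{m,g},$$ where $I_n=\sum_{m'\ne m}|H^{m',g}_n|^2\sum_{j\in\mathcal{U}^{m',g}}p_j$ and $S^{m,g}_n=|H^{m,g}_n|^2/(I_n+\sigma^2)$ (ties in $S$ broken by a fixed labelling of users, $S_i>S_n$ meaning $i$ comes after $n$). Such a solution is assumed to exist for every assignment; virtual users get power $0$. $P^g$ denotes the total power of all users (in all BSs) assigned to channel $g$; it depends only on which users are assigned to $g$. The total transmit power is $P_t=\sum_{g\in\mathcal{G}}P^g$ (equivalently, the total power of the real users). Moves: $(n\rightarrow g)$ means moving user $n$ to channel $g$ within its BS. All channels $\pi_{n_k}$ are those before any move, and listed moves are carried out simultaneously. Graph: $G^m(\mathcal{V}^e,\mathcal{E}^e,\mathcal{W}^e;\bm{\pi}^e)$ has as nodes the real and virtual users of BS $m$; there is an edge $n\to\tilde n$ iff $\pi_n\ne\pi_{\tilde n}$, with weight $$\bigtriangleup^{\pi_{\tilde n}}(n\twoheadrightarrow\tilde n)=P^{\pi_{\tilde n}}\big|_{\text{after}}-P^{\pi_{\tilde n}}\big|_{\text{before}},$$ where ''before'' refers to the current assignment, and ''after'' to the set of users on channel $\pi_{\tilde n}$ obtained by adding $n$ and removing $\tilde n$. A negative differ-group loop is a directed cycle $n_1\to n_2\to\cdots\to n_i\to n_1$ in this graph whose users lie in pairwise different groups and whose sum of edge weights is negative. *)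

(* Defs.v *)
From mathcomp Require Import all_boot all_order all_algebra.
From mathcomp Require Import reals exp complex.

Set Implicit Arguments.
Unset Strict Implicit.
Unset Printing Implicit Defensive.

Import Order.TTheory GRing.Theory Num.Theory.
Local Open Scope ring_scope.

(* [inl n] is a real user; [inr (m, g)] is the virtual user of group mg. *)
Definition user (M N G : nat) : finType := ('I_N + 'I_M * 'I_G)%type.

Record noma_system (R : realType) (M N G : nat) := NomaSystem {
  real_bs : 'I_N -> 'I_M;
  coef : 'I_M -> 'I_G -> user M N G -> R[i];
  sigma2 : R;
  real_rate : 'I_N -> R;
  (* the fixed labelling of the users that breaks ties in the decoding order *)
  label : user M N G -> nat;
  coef_neq0 : forall m g n, coef m g n != 0;
  sigma2_gt0 : 0 < sigma2;
  real_rate_ge0 : forall n, 0 <= real_rate n;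
  label_inj : injective label }.

Definition assignment (M N G : nat) := {ffun user M N G -> 'I_G}.

Definition with_virtual (M N G : nat) (pi0 : {ffun 'I_N -> 'I_G}) :
    assignment M N G :=
  [ffun n => match n with inl u => pi0 u | inr (_, g) => g end].

Definition bs (R : realType) (M N G : nat) (S : noma_system R M N G)
    (n : user M N G) : 'I_M :=
  match n with inl u => real_bs S u | inr (m, _) => m end.

Definition rate (R : realType) (M N G : nat) (S : noma_system R M N G)
    (n : user M N G) : R :=
  match n with inl u => real_rate S u | inr _ => 0 end.

(* |H|^2; in R[i] the norm is complex-valued (with zero imaginary part),
   hence the real part. *)
Definition gain (R : realType) (M N G : nat) (S : noma_system R M N G)
    (m : 'I_M) (g : 'I_G) (n : user M N G) : R :=
  complex.Re `|coef S m g n| ^+ 2.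

Definition group (R : realType) (M N G : nat) (S : noma_system R M N G)
    (pi : assignment M N G) (m : 'I_M) (g : 'I_G) : {set user M N G} :=
  [set n | (bs S n == m) && (pi n == g)].

Definition interference (R : realType) (M N G : nat) (S : noma_system R M N G)
    (pi : assignment M N G) (p : user M N G -> R) (n : user M N G) : R :=
  \sum_(m' < M | m' != bs S n)
     gain S m' (pi n) n * \sum_(j in group S pi m' (pi n)) p j.

Definition snr (R : realType) (M N G : nat) (S : noma_system R M N G)
    (pi : assignment M N G) (p : user M N G -> R) (n : user M N G) : R :=
  gain S (bs S n) (pi n) n / (interference S pi p n + sigma2 S).

(* "S_i > S_n", ties included *)
Definition snr_after (R : realType) (M N G : nat) (S : noma_system R M N G)
    (pi : assignment M N G) (p : user M N G -> R) (n i : user M N G) : bool :=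
  (snr S pi p n < snr S pi p i) ||
  ((snr S pi p i == snr S pi p n) && (label S n < label S i)%N).

Definition power_solution (R : realType) (M N G : nat)
    (S : noma_system R M N G) (pi : assignment M N G)
    (p : user M N G -> R) : Prop :=
  forall n : user M N G,
    0 <= p n /\
    p n = (2 `^ rate S n - 1) *
      ((interference S pi p n + sigma2 S) / gain S (bs S n) (pi n) n
       + \sum_(i in group S pi (bs S n) (pi n) | snr_after S pi p n i) p i).

(* Below, [p pi] are the powers of all users under the assignment [pi]. *)
Definition channel_power (R : realType) (M N G : nat)
    (p : assignment M N G -> user M N G -> R) (pi : assignment M N G)
    (g : 'I_G) : R :=
  \sum_(n | pi n == g) p pi n.

Definition total_power (R : realType) (M N G : nat)
    (p : assignment M N G -> user M N G -> R) (pi : assignment M N G) : R :=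
  \sum_(g < G) channel_power p pi g.

(* n is added to the channel of n' and n' is removed from it.  An assignment
   is total, so n' is sent to some other channel (that of n); the power of the
   channel [pi n'] only depends on the users on it, see [users_replace]. *)
Definition replace (M N G : nat) (pi : assignment M N G) (n n' : user M N G) :
    assignment M N G :=
  [ffun x => if x == n then pi n' else if x == n' then pi n else pi x].

Lemma users_replace (M N G : nat) (pi : assignment M N G) (n n' : user M N G) :
  pi n != pi n' ->
  [set x | replace pi n n' x == pi n'] = n |: [set x | pi x == pi n'] :\ n'.
Proof.
move=> neq; apply/setP=> x; rewrite !inE ffunE.
case: (eqVneq x n) => [->|_]; first by rewrite eqxx.
by case: (eqVneq x n') => //= _; apply/negbTE.
Qed.

Definition edge (R : realType) (M N G : nat) (S : noma_system R M N G)
    (m : 'I_M) (pi : assignment M N G) : rel (user M N G) :=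
  fun n n' => [&& bs S n == m, bs S n' == m & pi n != pi n'].

Definition weight (R : realType) (M N G : nat)
    (p : assignment M N G -> user M N G -> R) (pi : assignment M N G)
    (n n' : user M N G) : R :=
  channel_power p (replace pi n n') (pi n') - channel_power p pi (pi n').

(* The loop n_1 -> ... -> n_i -> n_1 is the sequence [:: n_1; ...; n_i].  The
   empty sequence is excluded by the sign condition, and all users being at the
   same BS, their groups differ exactly when their channels do. *)
Definition negative_differ_group_loop (R : realType) (M N G : nat)
    (S : noma_system R M N G) (p : assignment M N G -> user M N G -> R)
    (m : 'I_M) (pi : assignment M N G) (c : seq (user M N G)) : Prop :=
  [/\ path.cycle (edge S m pi) c,
      uniq [seq pi n | n <- c] &
      \sum_(n <- c) weight p pi n (next c n) < 0].

(* the simultaneous moves n_1 -> pi n_2, ..., n_i -> pi n_1 *)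
Definition shift_along (M N G : nat) (pi : assignment M N G)
    (c : seq (user M N G)) : assignment M N G :=
  [ffun n => if n \in c then pi (next c n) else pi n].

(* Main.v *)
Require Import Defs.
From mathcomp Require Import all_boot all_order all_algebra.
From mathcomp Require Import reals exp complex.
From mathcomp Require Import ring lra.

(* Within a cell, eliminating the powers from the strongest user to the weakest
   gives the cell power as a function of the noise levels t_n = 1 / S_n that is
   linear with nonnegative coefficients for a fixed decoding order, and an
   exchange argument shows that the order by decreasing t_n minimises it.  Hence
   the cell power is a monotone and homogeneous function of the t_n, and the
   cell powers of a channel form a fixed point of a standard interference
   function in the sense of Yates.  Such a fixed point is unique, so the power
   of a channel depends only on the set of its users.  Finally, the channels met
   by a differ-group loop are distinct, so that shifting along the loop acts on
   the channel of each head of an edge as the replacement defining the weight of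
   this edge, and the other channels are untouched: the total power changes by
   the sum of the weights. *)

Set Implicit Arguments.
Unset Strict Implicit.
Unset Printing Implicit Defensive.

Import Order.TTheory GRing.Theory Num.Theory.
Local Open Scope ring_scope.

(** * Cell power under successive interference cancellation *)

Section SuccessiveCancellation.
Variables (R : realFieldType) (T : eqType) (a : T -> R).
Hypothesis a_ge1 : forall x, 1 <= a x.
Implicit Types (t : T -> R) (s : seq T).

(* The head of [s] is the weakest user: all the others interfere with it. *)
Fixpoint sic_power t s : R :=
  if s is x :: s' then a x * sic_power t s' + (a x - 1) * t x else 0.

(** In the application [a x] is 2 to the rate of [x] and [t x] its noise level. The whole tail
    interferes with the head while, by asymmetry of [r], the head does not interfere with the tail,
    so the tail solves the same equations on its own. *)
Lemma sum_sic_power t (r : rel T) (p : T -> R) s :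
  irreflexive r -> (forall x y, r x y -> ~~ r y x) -> pairwise r s ->
  {in s, forall x, p x = (a x - 1) * (t x + \sum_(i <- s | r x i) p i)} ->
  \sum_(x <- s) p x = sic_power t s.
Proof.
move=> rI rA; elim: s => [|x s IHs] /=; first by rewrite big_nil.
case/andP=> /allP rx rs pE; rewrite big_cons -IHs //; last first.
  move=> y ys; rewrite pE ?in_cons ?ys ?orbT // big_cons.
  by rewrite (negbTE (rA _ _ (rx _ ys))).
rewrite pE ?mem_head // big_cons rI.
rewrite (_ : \sum_(i <- s | r x i) p i = \sum_(i <- s) p i); first by ring.
rewrite big_seq_cond [RHS]big_seq_cond; apply: eq_bigl => i.
by case: (boolP (i \in s)) => //= /rx ->.
Qed.

(** The right-hand side is the power once [w] is brought to the front. Moving [w] past the user [v]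
    just ahead of it adds [(a v - 1) * (a w - 1) * (t v - t w)] to the power of the list from there
    on, which is nonnegative for a sorted list. *)
Lemma sic_power_rem t s w :
  pairwise [rel x y | t y <= t x] s -> w \in s ->
  sic_power t s <= a w * sic_power t (rem w s) + (a w - 1) * t w.
Proof.
elim: s => //= v s IHs /andP[/allP tv ts]; rewrite in_cons [w == v]eq_sym.
case: eqVneq => [->//|_] /= ws; have le_wv := tv _ ws.
have := IHs ts ws; have := a_ge1 v; have := a_ge1 w.
set X := sic_power t (rem w s); set Y := sic_power t s.
set av := a v; set aw := a w => w1 v1 leY.
have : av * Y <= av * (aw * X + (aw - 1) * t w) by rewrite ler_wpM2l //; lra.
have : 0 <= (av - 1) * (aw - 1) * (t v - t w) by rewrite !mulr_ge0 //= subr_ge0.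
by nra.
Qed.

Lemma sic_power_sorted_min t s s' :
  pairwise [rel x y | t y <= t x] s -> perm_eq s s' ->
  sic_power t s <= sic_power t s'.
Proof.
elim: s' s => [|w s' IHs'] s ts; first by move/perm_nilP->.
move=> ss'; have ws : w \in s by rewrite (perm_mem ss') mem_head.
apply: le_trans (sic_power_rem ts ws) _ => /=.
rewrite lerD2r ler_wpM2l ?(le_trans ler01) // IHs' //.
  exact: subseq_pairwise (rem_subseq _ _) ts.
by rewrite -(perm_cons w) -(permPl (perm_to_rem ws)).
Qed.

Lemma ler_sic_power t t' s :
  {in s, forall x, t x <= t' x} -> sic_power t s <= sic_power t' s.
Proof.
elim: s => //= x s IHs tt'; have a1 := a_ge1 x.
apply: lerD; rewrite ler_wpM2l ?subr_ge0 ?(le_trans ler01) ?tt' ?mem_head //.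
by apply: IHs => y ys; rewrite tt' // in_cons ys orbT.
Qed.

(** A user with [1 < a x] makes its own noise term strictly increasing, and the positive factors of
    the users ahead of it preserve this. *)
Lemma ltr_sic_power t t' s :
  {in s, forall x, t x < t' x} -> has [pred x | 1 < a x] s ->
  sic_power t s < sic_power t' s.
Proof.
elim: s => //= x s IHs tt' ax; have a1 := a_ge1 x.
have a0 : 0 < a x by apply: lt_le_trans a1.
have ttx : t x < t' x by rewrite tt' ?mem_head.
have tts : {in s, forall y, t y < t' y}.
  by move=> y ys; rewrite tt' // in_cons ys orbT.
case/orP: ax => [ax|/(IHs tts) ax].
  apply: ler_ltD; last by rewrite ltr_pM2l ?subr_gt0.
  by rewrite ler_pM2l // ler_sic_power // => y /tts/ltW.
by apply: ltr_leD; rewrite ?ltr_pM2l // ler_wpM2l ?subr_ge0 // ltW.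
Qed.

Lemma sic_powerZ b t s : sic_power (fun x => b * t x) s = b * sic_power t s.
Proof. by elim: s => /= [|x s ->]; [rewrite mulr0 | ring]. Qed.

End SuccessiveCancellation.

(** * Uniqueness of the cell powers on a channel *)

Definition noise_level (R : realType) (M N G : nat) (S : noma_system R M N G)
    (pi : assignment M N G) (p : user M N G -> R) (n : user M N G) : R :=
  (interference S pi p n + sigma2 S) / gain S (bs S n) (pi n) n.

Definition cell_power (R : realType) (M N G : nat) (S : noma_system R M N G)
    (pi : assignment M N G) (p : user M N G -> R) (g : 'I_G) (m : 'I_M) : R :=
  \sum_(j in group S pi m g) p j.

Section PowerSolution.
Variables (R : realType) (M N G : nat) (S : noma_system R M N G).
Implicit Types (pi : assignment M N G) (p : user M N G -> R).

Lemma gain_gt0 m g n : 0 < gain S m g n.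
Proof.
have : 0 < `|coef S m g n| by rewrite normr_gt0 coef_neq0.
by rewrite ltcE => /andP[_ ?]; apply: exprn_gt0.
Qed.

Lemma rate_factor_ge1 n : 1 <= 2 `^ rate S n :> R.
Proof.
rewrite -[leLHS](powRr0 2); apply: ler_powR; first by rewrite ler1n.
by case: n => [u|//] /=; apply: real_rate_ge0.
Qed.

(** Other cells matter only through their total powers, so the cell powers of one channel form a
    closed system. *)
Lemma interferenceE pi p n :
  interference S pi p n =
    \sum_(m' < M | m' != bs S n) gain S m' (pi n) n * cell_power S pi p (pi n) m'.
Proof. by []. Qed.

Lemma snr_noise_level pi p n : snr S pi p n = (noise_level S pi p n)^-1.
Proof. by rewrite /snr /noise_level invf_div. Qed.

Lemma snr_after_irr pi p : irreflexive (snr_after S pi p).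
Proof. by move=> x; rewrite /snr_after ltxx ltnn andbF. Qed.

Lemma snr_after_trans pi p : transitive (snr_after S pi p).
Proof.
move=> y x z; rewrite /snr_after => /orP[xy|/andP[/eqP-> xy]].
  case/orP=> [yz|/andP[/eqP-> _]]; last by rewrite xy.
  by rewrite (lt_trans xy yz).
by case/orP=> [->//|/andP[-> yz]]; rewrite (ltn_trans xy yz) orbT.
Qed.

Lemma snr_after_total pi p x y :
  x != y -> snr_after S pi p x y || snr_after S pi p y x.
Proof.
move=> xy; rewrite /snr_after; case: ltgtP => //= _.
by rewrite -neq_ltn (inj_eq (@label_inj _ _ _ _ S)).
Qed.

Section Solution.
Variables (pi : assignment M N G) (p : user M N G -> R).
Hypothesis solp : power_solution S pi p.

Lemma cell_power_ge0 g m : 0 <= cell_power S pi p g m.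
Proof. by apply: sumr_ge0 => j _; case: (solp j). Qed.

Lemma noise_level_gt0 n : 0 < noise_level S pi p n.
Proof.
rewrite divr_gt0 ?gain_gt0 // ltr_wpDl ?sigma2_gt0 // interferenceE.
by apply: sumr_ge0 => m' _; rewrite mulr_ge0 ?cell_power_ge0 // ltW ?gain_gt0.
Qed.

(** The right-hand side does not involve [p]: two solutions with the same groups vanish in the same
    cells, which makes the ratios of their cell powers usable. *)
Lemma cell_power_gt0 g m :
  (0 < cell_power S pi p g m) =
    has [pred n | 1 < 2 `^ rate S n] (enum (group S pi m g)).
Proof.
apply/idP/hasP => [Q0|[n]]; last first.
  rewrite mem_enum /= => nA rn; rewrite /cell_power (bigD1 n) //=.
  apply: ltr_pwDl; last by apply: sumr_ge0 => j _; case: (solp j).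
  case: (solp n) => _ ->; rewrite mulr_gt0 ?subr_gt0 //.
  apply: ltr_pwDl; first exact: noise_level_gt0.
  by apply: sumr_ge0 => j _; case: (solp j).
apply/hasP/negPn/negP => /hasPn norate; move: Q0.
rewrite /cell_power big1 ?ltxx // => n nA; case: (solp n) => _ ->.
have := norate n; rewrite mem_enum /= => /(_ nA); rewrite -leNgt => rn.
suff -> : 2 `^ rate S n = 1 :> R by rewrite subrr mul0r.
by apply/le_anti; rewrite rn rate_factor_ge1.
Qed.

Lemma cell_power_sic g m :
  exists2 s, perm_eq s (enum (group S pi m g)) &
    pairwise [rel x y | noise_level S pi p y <= noise_level S pi p x] s /\
    cell_power S pi p g m
      = sic_power (fun n => 2 `^ rate S n) (noise_level S pi p) s.
Proof.
(* Sorting asks for a total relation, hence the reflexive closure of the decoding order; the strict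
   order is recovered below from the absence of duplicates. *)
set r := snr_after S pi p; pose le := [rel x y | (x == y) || r x y].
have le_total : total le.
  move=> x y /=; case: eqVneq => //= /(snr_after_total pi p).
  by rewrite -/r => /orP[] ->; rewrite ?orbT.
have le_trans : transitive le.
  move=> y x z /= /orP[/eqP->//|xy] /orP[/eqP<-|yz]; first by rewrite xy orbT.
  by rewrite /r (snr_after_trans xy yz) orbT.
pose A := enum (group S pi m g); pose s := sort le A.
have sA : perm_eq s A by rewrite perm_sort.
have memA x : (x \in s) = (x \in group S pi m g).
  by rewrite (perm_mem sA) mem_enum.
have rs : pairwise r s.
  have : pairwise le s by rewrite -sorted_pairwise // sort_sorted.
  have : uniq s by rewrite (perm_uniq sA) enum_uniq.
  rewrite uniq_pairwise => us ls.
  have : pairwise [rel x y | (x != y) && le x y] s by rewrite pairwise_relI us.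
  by apply: sub_pairwise => x y /= /andP[/negbTE->].
have sumE P : \sum_(i in group S pi m g | P i) p i = \sum_(i <- s | P i) p i.
  by rewrite (perm_big _ sA) /= big_enum_cond.
exists s => //; split.
  apply: sub_pairwise rs => x y /= rxy.
  rewrite -lef_pV2 ?posrE ?noise_level_gt0 // -!snr_noise_level.
  by case/orP: rxy => [/ltW//|/andP[/eqP-> _]].
rewrite -(@sum_sic_power _ _ _ _ r p s) //; first 1 last.
- exact: snr_after_irr.
- move=> x y xy; apply/negP => /(snr_after_trans xy).
  by rewrite snr_after_irr.
- move=> x; rewrite memA => xA; case: (solp x) => _ {1}->.
  by rewrite -sumE; move: xA; rewrite inE => /andP[/eqP<- /eqP<-].
by rewrite [RHS](perm_big _ sA) big_enum.
Qed.

End Solution.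

(** If the claim fails, take a cell [m] where the ratio [b] of the two powers is largest, so
    [b > 1]. Scaling the second solution by [b] dominates the first in all cells, and yet strictly
    exceeds it in [m] because the noise was scaled too, contradicting the choice of [b]. *)
Lemma cell_power_le pi1 pi2 p1 p2 g :
  power_solution S pi1 p1 -> power_solution S pi2 p2 ->
  (forall n, (pi1 n == g) = (pi2 n == g)) ->
  forall m, cell_power S pi1 p1 g m <= cell_power S pi2 p2 g m.
Proof.
move=> sol1 sol2 eqg.
have eqA m : group S pi1 m g = group S pi2 m g.
  by apply/setP=> n; rewrite !inE eqg.
set Q1 := cell_power S pi1 p1 g; set Q2 := cell_power S pi2 p2 g.
have Q1_0 m : 0 <= Q1 m by apply: cell_power_ge0.
have Q2_0 m : 0 <= Q2 m by apply: cell_power_ge0.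
have Q12_0 m : (0 < Q1 m) = (0 < Q2 m).
  by rewrite /Q1 /Q2 !cell_power_gt0 // eqA.
move=> m0; rewrite leNgt; apply/negP => ltm0.
case: (@arg_maxP _ _ _ m0 xpredT (fun m => Q1 m / Q2 m)) => // m _ maxm.
set b := Q1 m / Q2 m in maxm.
have b1 : 1 < b.
  apply: lt_le_trans (maxm m0 isT); rewrite ltr_pdivlMr ?mul1r //.
  by rewrite -Q12_0; apply: le_lt_trans ltm0.
(* Division by zero yields 0, so [b > 1] rules out [Q2 m = 0]. *)
have Q2m : 0 < Q2 m.
  rewrite lt_def Q2_0 andbT; apply: contraTneq b1 => Q2m.
  by rewrite /b Q2m invr0 mulr0 ltr10.
have leQ m' : Q1 m' <= b * Q2 m'.
  have [Q2m'|Q2m'] := ltrP 0 (Q2 m'); first by rewrite -ler_pdivrMr //; apply: maxm.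
  apply: (@le_trans _ _ 0); first by rewrite leNgt Q12_0 -leNgt.
  by rewrite mulr_ge0 // ltW // (lt_trans ltr01).
have [s1 s1A [sorted1 Q1E]] := cell_power_sic sol1 g m.
have [s2 s2A [_ Q2E]] := cell_power_sic sol2 g m.
have s12 : perm_eq s1 s2 by rewrite (permPl s1A) perm_sym (permPl s2A) eqA.
have lt12 : {in s2, forall n,
    noise_level S pi1 p1 n < b * noise_level S pi2 p2 n}.
  move=> n; rewrite (perm_mem s2A) mem_enum => nA2.
  have := nA2; rewrite -eqA !inE => /andP[_ /eqP pi1n].
  move: nA2; rewrite inE => /andP[_ /eqP pi2n].
  rewrite /noise_level mulrA !interferenceE pi1n pi2n.
  rewrite ltr_pM2r ?invr_gt0 ?gain_gt0 // mulrDr.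
  (* The strictness comes from the noise: [sigma2 S < b * sigma2 S]. *)
  apply: ler_ltD; last by rewrite ltr_pMl // sigma2_gt0.
  rewrite mulr_sumr; apply: ler_sum => m' _.
  by rewrite mulrCA ler_pM2l ?gain_gt0 ?leQ.
(* The two solutions may decode in different orders. As [s1] is optimal for the first noise levels,
   passing to [s2] can only raise the power, and both sides are then compared along [s2]. *)
have : Q1 m < b * Q2 m.
  rewrite /Q1 Q1E; apply: le_lt_trans (sic_power_sorted_min _ sorted1 s12) _.
    exact: rate_factor_ge1.
  rewrite /Q2 Q2E -sic_powerZ; apply: ltr_sic_power => //.
    exact: rate_factor_ge1.
  by rewrite (perm_has _ s2A) -(cell_power_gt0 sol2).
by rewrite /b divfK ?ltxx // gt_eqF.
Qed.

(** Where the users off channel [g] are sent is thus irrelevant, which lets [shift_along] and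
    [replace] be compared one channel at a time. *)
Lemma channel_power_eq (p : assignment M N G -> user M N G -> R) pi1 pi2 g :
  (forall pi, power_solution S pi (p pi)) ->
  (forall n, (pi1 n == g) = (pi2 n == g)) ->
  channel_power p pi1 g = channel_power p pi2 g.
Proof.
move=> solp eqg.
have cellE pi : channel_power p pi g = \sum_(m < M) cell_power S pi (p pi) g m.
  rewrite /channel_power (partition_big (bs S) xpredT) //=.
  by apply: eq_bigr => m _; apply: eq_bigl => n; rewrite inE andbC.
rewrite !cellE; apply: eq_bigr => m _; apply/le_anti.
by rewrite !cell_power_le.
Qed.

End PowerSolution.

(** * Shifting users along a loop *)

Section Shift.
Variables (M N G : nat) (pi : assignment M N G) (c : seq (user M N G)).
Hypothesis uniq_pi_c : uniq [seq pi n | n <- c].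

Let uniq_c : uniq c := map_uniq uniq_pi_c.

Let pi_inj : {in c &, injective pi}.
Proof.
move=> x y xc yc pi_xy; apply: (index_inj x xc yc); apply/eqP.
rewrite -(nth_uniq (pi x) _ _ uniq_pi_c) ?size_map ?index_mem //.
by rewrite !(nth_map x) ?index_mem // !nth_index // pi_xy.
Qed.

(** A loop user other than [n] cannot arrive on the channel of [next c n], since both [next c] and
    [pi] are injective on the loop; and [next c n] is the only loop user to leave it. *)
Lemma shift_along_replace n :
  n \in c -> pi n != pi (next c n) ->
  forall x, (shift_along pi c x == pi (next c n))
            = (replace pi n (next c n) x == pi (next c n)).
Proof.
move=> nc neq x; rewrite !ffunE.
have [->|xn] := eqVneq x n; first by rewrite nc.
case: ifP => [xc|xc]; last first.
  case: (eqVneq x (next c n)) => // xn'.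
  by rewrite xn' mem_next nc in xc.
have next_inj : next c x == next c n -> x = n.
  by move/eqP/(congr1 (prev c)); rewrite !prev_next.
rewrite (inj_in_eq pi_inj) ?mem_next //.
case: (eqVneq x (next c n)) => xn'.
  by rewrite (negbTE neq); apply/negbTE/negP => /next_inj/eqP; rewrite (negbTE xn).
rewrite (inj_in_eq pi_inj) ?mem_next // (negbTE xn').
by apply/negbTE/negP => /next_inj/eqP; rewrite (negbTE xn).
Qed.

Lemma shift_along_notin g :
  g \notin [seq pi n | n <- c] ->
  forall x, (shift_along pi c x == g) = (pi x == g).
Proof.
move=> gc x; rewrite ffunE; case: ifP => // xc.
have neq y : y \in c -> (pi y == g) = false.
  by move=> yc; apply: contraNF gc => /eqP <-; apply: map_f.
by rewrite !neq ?mem_next.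
Qed.

End Shift.

Lemma total_power_shift_along (R : realType) (M N G : nat)
    (S : noma_system R M N G) (p : assignment M N G -> user M N G -> R)
    (pi : assignment M N G) (c : seq (user M N G)) :
  (forall pi', power_solution S pi' (p pi')) ->
  uniq [seq pi n | n <- c] -> {in c, forall n, pi n != pi (next c n)} ->
  total_power p (shift_along pi c) - total_power p pi
    = \sum_(n <- c) weight p pi n (next c n).
Proof.
move=> solp upi neq; have uc := map_uniq upi.
rewrite /total_power -sumrB (bigID (mem [seq pi n | n <- c])) /=.
rewrite [X in _ + X]big1 => [|g gc]; last first.
  rewrite (channel_power_eq solp (shift_along_notin gc)); apply: subrr.
rewrite addr0 -big_uniq //= big_map.
(* The weight of an edge concerns the channel of its head, so the sum over the loop is reindexed by
   [next c], which permutes [c]. *)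
rewrite [LHS](perm_big [seq next c n | n <- c]) /=; last first.
  rewrite perm_sym; apply: uniq_perm => //.
    by rewrite map_inj_uniq //; apply: can_inj (prev_next uc).
  move=> x; apply/mapP/idP => [[y yc ->]|xc]; first by rewrite mem_next.
  by exists (prev c x); rewrite ?mem_prev ?next_prev.
rewrite big_map big_seq [RHS]big_seq; apply: eq_bigr => n nc.
by rewrite /weight (channel_power_eq solp (shift_along_replace upi nc (neq n nc))).
Qed.

Theorem theorem4 (R : realType) (M N G : nat) (S : noma_system R M N G)
    (p : assignment M N G -> user M N G -> R)
    (hp : forall pi : assignment M N G, power_solution S pi (p pi))
    (m : 'I_M) (pi0 : {ffun 'I_N -> 'I_G}) (c : seq (user M N G))
    (hc : negative_differ_group_loop S p m (with_virtual M pi0) c) :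
  total_power p (shift_along (with_virtual M pi0) c)
    < total_power p (with_virtual M pi0).
Proof.
case: hc => edges upi; rewrite -(total_power_shift_along hp upi) ?subr_lt0 //.
by move=> n nc; have /and3P[_ _] := next_cycle edges nc.
Qed.
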